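(* Let $I=[a,b]\subset\mathbb{R}$, let $\varphi:I\to I$, let $s\in(0,1)$, and let $f:I\to[0,\infty)$ be a $\varphi_s$-convex function. Then: (i) if $\varphi$ is linear, then $f\circ\varphi$ is $s$-convex in the second sense on $I$; (ii) if $f$ is increasing and $\varphi$ is convex, then $f\circ\varphi$ is $s$-convex in the second sense on $I$.
   Context: A function $f:I\to[0,\infty)$ is $\varphi_s$-convex ($s\in(0,1)$) if $f(t\varphi(x)+(1-t)\varphi(y))\le t^s f(\varphi(x))+(1-t)^s f(\varphi(y))$ for all $x,y\in I$ and $t\in(0,1)$. A function $g:I\to[0,\infty)$ is $s$-convex in the second sense if $g(\lambda x+(1-\lambda)y)\le\lambda^s g(x)+(1-\lambda)^s g(y)$ for all $x,y\in I$ and $\lambda\in[0,1]$. ''$\varphi$ is linear'' means $\varphi(\lambda x+(1-\lambda)y)=\lambda\varphi(x)+(1-\lambda)\varphi(y)$ for all $x,y\in I$, $\lambda\in[0,1]$. ''Increasing'' means $u\le v$ implies $f(u)\le f(v)$. *)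

(* Defs.v *)
From HB Require Import structures.
From mathcomp Require Import all_boot all_order all_algebra.
From mathcomp Require Import all_classical all_reals all_analysis.

Set Implicit Arguments.
Unset Strict Implicit.
Unset Printing Implicit Defensive.

Import Order.TTheory GRing.Theory Num.Theory.

Local Open Scope classical_set_scope.
Local Open Scope ring_scope.

(* A function with domain I is a total function R -> R of which only the
   values on I matter; the codomain [0, +oo) is part of both notions of
   convexity below. *)

Definition phi_s_convex (R : realType) (I : set R) (phi : R -> R) (s : R)
    (f : R -> R) : Prop :=
  set_fun I `[0, +oo[ f /\
  forall x y t : R, I x -> I y -> 0 < t < 1 ->
    f (t * phi x + (1 - t) * phi y) <=
      t `^ s * f (phi x) + (1 - t) `^ s * f (phi y).

(* At the endpoints, 0 `^ s = 0 because s != 0 in the intended range of s. *)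
Definition s_convex_second (R : realType) (I : set R) (s : R)
    (g : R -> R) : Prop :=
  set_fun I `[0, +oo[ g /\
  forall x y t : R, I x -> I y -> 0 <= t <= 1 ->
    g (t * x + (1 - t) * y) <= t `^ s * g x + (1 - t) `^ s * g y.

(* "Linear" in the sense of preserving convex combinations of points of I. *)
Definition linear_on (R : realType) (I : set R) (phi : R -> R) : Prop :=
  forall x y t : R, I x -> I y -> 0 <= t <= 1 ->
    phi (t * x + (1 - t) * y) = t * phi x + (1 - t) * phi y.

(* Main.v *)
Require Import Defs.
From HB Require Import structures.
From mathcomp Require Import all_boot all_order all_algebra.
From mathcomp Require Import all_classical all_reals all_analysis.
From mathcomp Require Import lra.

Set Implicit Arguments.
Unset Strict Implicit.
Unset Printing Implicit Defensive.

Import Order.TTheory GRing.Theory Num.Theory.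

Local Open Scope classical_set_scope.
Local Open Scope ring_scope.

(** For [0 < t < 1], [phi_s_convex] bounds [f] at [t * phi x + (1 - t) * phi y] by exactly the
    required right-hand side. It remains to compare this with [f (phi (t * x + (1 - t) * y))]: the
    two are equal when [phi] is linear, and convexity of [phi] followed by monotonicity of [f] gives
    [<=] otherwise. The endpoint values of [t] are left to [s_convex_second_open]. *)

Lemma itvcc_conv (R : realType) (a b x y t : R) :
  x \in `[a, b] -> y \in `[a, b] -> 0 <= t <= 1 ->
  t * x + (1 - t) * y \in `[a, b].
Proof.
rewrite !in_itv/= => /andP[ax xb] /andP[ay yb] /andP[t0 t1].
by apply/andP; split; nra.
Qed.

(** At [t = 0] and [t = 1] the inequality is an equality, because [s != 0] gives [0]^ s =
    0[, while]1 [^ s = 1]. *)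
Lemma s_convex_second_open (R : realType) (I : set R) (s : R) (g : R -> R) :
  s != 0 -> set_fun I `[0, +oo[ g ->
  (forall x y t : R, I x -> I y -> 0 < t < 1 ->
    g (t * x + (1 - t) * y) <= t `^ s * g x + (1 - t) `^ s * g y) ->
  s_convex_second I s g.
Proof.
move=> s0 g0 gconv; split=> // x y t Ix Iy /andP[].
rewrite le_eqVlt => /predU1P[<- _|t0].
  by rewrite subr0 powR0// powR1 !mul0r !mul1r !add0r.
rewrite le_eqVlt => /predU1P[->|t1].
  by rewrite subrr powR0// powR1 !mul0r !mul1r !addr0.
by apply: gconv => //; rewrite t0.
Qed.

Theorem theorem1 (R : realType) (a b : R) (phi : R -> R) (s : R) (f : R -> R)
    (hphi : set_fun `[a, b] `[a, b] phi)
    (hs : 0 < s < 1)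
    (hf : phi_s_convex `[a, b] phi s f) :
  (linear_on `[a, b] phi -> s_convex_second `[a, b] s (f \o phi)) /\
  ({in `[a, b] &, {homo f : u v / u <= v}} ->
   convex_function (E := R^o) `[a, b] phi ->
   s_convex_second `[a, b] s (f \o phi)).
Proof.
have s0 : s != 0 by rewrite gt_eqF//; case/andP: hs.
case: hf => f0 fconv.
have fphi0 : set_fun `[a, b] `[0, +oo[ (f \o phi).
  by move=> x Ix; exact/f0/hphi.
split=> [philin | finc phiconv]; apply: s_convex_second_open => // x y t Ix Iy t01.
  by rewrite /= philin ?fconv//; case/andP: t01 => /ltW-> /ltW.
have t01' : 0 <= t <= 1 by case/andP: t01 => /ltW-> /ltW.
apply: le_trans (fconv _ _ _ Ix Iy t01).
(* Monotonicity is known only on [[a, b]], so both arguments of [f] must be shown to lie there. *)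
apply: finc.
- exact/hphi/itvcc_conv.
- by apply: itvcc_conv => //; exact: hphi.
- case/andP: t01' => t0 t1.
  (* Over [R^o], the abstract convex combination of weight [Itv01 t0 t1] unfolds to
     [t * x + (1 - t) * y]. *)
  by apply: (phiconv (Itv01 t0 t1)); exact: mem_set.
Qed.
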